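(* Let $X$ be a complex Hilbert space and let $T\in\mathcal{B}(X)$ be a power-bounded operator such that $\sigma(T)\cap\mathbb{T}=\{1\}$. Let $\alpha\geq1$. Then $\|R(\mathrm{e}^{\mathrm{i}\theta},T)\|=O(|\theta|^{-\alpha})$ as $\theta\to0$ if and only if $\|T^n(I-T)\|=O(n^{-1/\alpha})$ as $n\to\infty$.
   Context: $T$ is power-bounded if $\sup_{n\geq0}\|T^n\|<\infty$; $\mathbb{T}$ is the unit circle; $R(\lambda,T)=(\lambda-T)^{-1}$. *)

(* Defs.v *)
(* MathComp-Analysis over an abstract R : realType;
   the complex field is mathcomp-real-closed's  R[i] = complex R. *)
From mathcomp Require Import all_boot all_order all_algebra.
From mathcomp Require Import all_classical all_reals all_analysis.
From mathcomp Require Export complex.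
Import GRing.Theory Num.Theory ComplexField.

Set Implicit Arguments.
Unset Strict Implicit.
Unset Printing Implicit Defensive.

Local Open Scope ring_scope.
Local Open Scope complex_scope.

Section Defs.
Variables (R : realType) (V : normedModType R[i]).

(* The norm of V is compatible with an inner product: V is an inner-product
   space; together with completeness (completeNormedModType) V is a complex
   Hilbert space.  ip is linear in the first argument, conjugate symmetric,
   and induces the norm. *)
Definition is_inner_product (ip : V -> V -> R[i]) : Prop :=
  [/\ (forall (a : R[i]) (x y z : V), ip (a *: x + y) z = a * ip x z + ip y z),
      (forall x y : V, ip y x = (ip x y)^*) &
      (forall x : V, ip x x = `|x| ^+ 2)].

Definition hilbert_norm : Prop := exists ip, is_inner_product ip.

(* bounded linear operators on V : elements of B(V) *)
Definition bounded_op (S : V -> V) : Prop :=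
  linear S /\ exists M : R, forall x, `|S x| <= M%:C * `|x|.

(* lambda - S *)
Definition shift_op (lam : R[i]) (S : V -> V) : V -> V := fun x => lam *: x - S x.

(* S is a (two-sided, bounded) inverse of A in B(V) *)
Definition is_inverse_op (A S : V -> V) : Prop :=
  bounded_op S /\ (forall x, S (A x) = x) /\ (forall x, A (S x) = x).

(* lam belongs to the spectrum of T : lam - T is not invertible in B(V) *)
Definition in_spectrum (T : V -> V) (lam : R[i]) : Prop :=
  ~ exists S, is_inverse_op (shift_op lam T) S.

Definition power_bounded (T : V -> V) : Prop :=
  exists M : R, forall (n : nat) (x : V), `|iter n T x| <= M%:C * `|x|.

End Defs.

(* e^{i theta} *)
Definition expi (R : realType) (theta : R) : R[i] := Complex (cos theta) (sin theta).

(* Main.v *)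
Require Import Defs.
From mathcomp Require Import all_boot all_order all_algebra.
From mathcomp Require Import all_classical all_reals all_analysis.
From mathcomp Require Import complex ring lra zify.
Import Order.TTheory GRing.Theory Num.Theory ComplexField.
Import numFieldNormedType.Exports.
Set Implicit Arguments.
Unset Strict Implicit.
Unset Printing Implicit Defensive.
Local Open Scope ring_scope.
Local Open Scope complex_scope.

(* Resolvent bound => decay.  For a hat function g on {0, ..., 2n} put
   v_k = g(k) T^k x and f_k = v_(k+1) - T v_k = (g(k+1) - g(k)) T^(k+1) x.  On the
   Fourier side over Z/2n, f is (lam - T) applied to v.  With y the transform of
   v at lam = e^(i t) and eps = n^(-1/alpha), one has
     |(I - T) y| <= eps |y| + D eps^(1-alpha) |(lam - T) y|
   for every t, by the trivial bound when |t| <= eps and by the resolvent bound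
   otherwise.  Parseval turns this into
     sum g(k)^2 |T^k (I - T) x|^2 = O(eps^2 n^3) |x|^2,
   and power-boundedness bounds the left side below by a multiple of
   n^3 |T^n (I - T) x|^2.

   Decay => resolvent bound.  If w = (lam - T) y, then T^n y differs from lam^n y
   by at most n M |w|, and (1 - lam) T^n y = T^n (I - T) y - T^n w; now take n of
   order |t|^(-alpha). *)

(* Norms over R[i] take values in R[i], with zero imaginary part. *)
Definition rnorm {R : realType} {V : normedModType R[i]} (x : V) : R :=
  complex.Re `|x|.

(** * Calculus of the real-valued norm *)

Section RealNorm.
Context {R : realType} {V : normedModType R[i]}.
Implicit Types (x y : V) (a : R[i]).

Lemma rnormE x : `|x| = (rnorm x)%:C.
Proof.
rewrite /rnorm; have := normr_ge0 x.
by case: `|x| => a b; rewrite lecE /= => /andP[/eqP -> _].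
Qed.

Lemma rnorm_le x y c : (`|x| <= c%:C * `|y|) = (rnorm x <= c * rnorm y).
Proof. by rewrite !rnormE -rmorphM /= lecR. Qed.

Lemma rnorm_ge0 x : 0 <= rnorm x.
Proof. by rewrite -lecR -rnormE normr_ge0. Qed.

Lemma rnormD x y : rnorm (x + y) <= rnorm x + rnorm y.
Proof. by rewrite -lecR rmorphD /= -!rnormE ler_normD. Qed.

Lemma rnormB x y : rnorm (x - y) <= rnorm x + rnorm y.
Proof. by rewrite -lecR rmorphD /= -!rnormE ler_normB. Qed.

Lemma rnormZ a x : rnorm (a *: x) = complex.Re `|a| * rnorm x.
Proof. by rewrite /rnorm normrZ (rnormE x) normc_def /=; simpc. Qed.

Lemma rnorm_sqr x : `|x| ^+ 2 = (rnorm x ^+ 2)%:C.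
Proof. by rewrite rnormE rmorphXn. Qed.

End RealNorm.

(** * Points and chords of the unit circle *)

Section UnitCircle.
Context {R : realType}.
Implicit Types (t : R).

Lemma norm_expi t : `|expi t| = 1.
Proof. by rewrite /expi normc_def /= cos2Dsin2 sqrtr1. Qed.

Lemma expiD s t : expi (s + t) = expi s * expi t.
Proof. by rewrite /expi cosD sinD; simpc; congr Complex; rewrite addrC. Qed.

Lemma expi0 : expi 0 = 1 :> R[i].
Proof. by rewrite /expi cos0 sin0. Qed.

Lemma expi_surj (a : R[i]) : `|a| = 1 ->
  exists2 t, - pi <= t <= pi & a = expi t.
Proof.
case: a => a b; rewrite normc_def => -[] /= h.
have {}h : a ^+ 2 + b ^+ 2 = 1.
  by rewrite -(@sqr_sqrtr _ (a ^+ 2 + b ^+ 2)) ?addr_ge0 ?sqr_ge0// h expr1n.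
have ha : -1 <= a <= 1 by apply/andP; split; nra.
have hb : `|b| = Num.sqrt (1 - a ^+ 2) by rewrite -h addrC addKr sqrtr_sqr.
have c0 := acos_ge0 ha; have c1 := acos_lepi ha.
have ca : cos (acos a) = a by apply: acosK; rewrite in_itv.
have [b0|b0] := leP 0 b.
- exists (acos a); first by apply/andP; split; lra.
  by rewrite /expi ca sin_acos // -hb ger0_norm.
- exists (- acos a); first by apply/andP; split; lra.
  by rewrite /expi cosN sinN ca sin_acos // -hb ltr0_norm // opprK.
Qed.

(** This form serves both sine bounds below: [cos c] is at most 1 everywhere and exceeds 1/2 near
    0. *)
Lemma sin_mvt t : 0 <= t -> exists2 c, 0 <= c <= t & sin t = cos c * t.
Proof.
move=> t0; have [|c ct] := @MVT_segment R sin cos 0 t t0 (fun x _ => is_derive_sin x).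
  exact/continuous_subspaceT/continuous_sin.
by rewrite sin0 !subr0; exists c => //; move: ct; rewrite in_itv.
Qed.

Lemma sin_le_norm t : `|sin t| <= `|t|.
Proof.
wlog t0 : t / 0 <= t => [H|].
  by have [/H//|t0] := leP 0 t; rewrite -normrN -sinN -(normrN t); apply: H; lra.
have [c _ ->] := sin_mvt t0; rewrite normrM ler_piMl//.
by rewrite ler_norml cos_geN1 cos_le1.
Qed.

Lemma sin_ge_half : exists2 d : R, 0 < d & forall t, `|t| < d -> `|t| / 2 <= `|sin t|.
Proof.
have /cvgrPdist_lt /(_ (2^-1)) [] := @continuous_cos R 0.
  by rewrite invr_gt0 ltr0n.
move=> d /= d0 H; exists d => // t.
wlog t0 : t / 0 <= t => [K|td].
  have [/K//|t0] := leP 0 t; rewrite -(normrN (sin t)) -sinN -(normrN t).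
  by apply: K; lra.
have [c /andP[c0 ct] ->] := sin_mvt t0.
have cd : `|0 - c| < d.
  by rewrite sub0r normrN ger0_norm //; apply: le_lt_trans td; rewrite ger0_norm.
have := H c cd; rewrite /= cos0 normrM mulrC => h.
apply: ler_wpM2r => //.
have := ler_norm (1 - cos c); have := ler_norm (cos c); lra.
Qed.

(** Half-angle formula for a chord: both squares equal [2 - 2 * cos (s - t)]. *)
Lemma norm_expiB s t : complex.Re `|expi s - expi t| = 2 * `|sin ((s - t) / 2)|.
Proof.
rewrite /expi normc_def /=.
have -> : (cos s - cos t) ^+ 2 + (sin s - sin t) ^+ 2
        = (2 * `|sin ((s - t) / 2)|) ^+ 2.
  rewrite exprMn real_normK ?num_real//.
  have := cosB s t; have -> : s - t = (s - t) / 2 + (s - t) / 2 by field.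
  rewrite cosD; have := cos2Dsin2 s; have := cos2Dsin2 t.
  have := cos2Dsin2 ((s - t) / 2).
  rewrite -(_ : (s - t) / 2 = ((s - t) / 2 + (s - t) / 2) / 2); last by field.
  nra.
by rewrite sqrtr_sqr ger0_norm ?mulr_ge0.
Qed.

End UnitCircle.

(** * Parseval's identity on a finite cyclic group *)

Section DiscreteFourier.
Context {R : realType}.

Lemma expi_natmul n (t : R) : expi t ^+ n = expi (n%:R * t).
Proof.
elim: n => [|n IHn]; first by rewrite mul0r expi0 expr0.
by rewrite exprSr IHn -expiD mulrSr mulrDl mul1r.
Qed.

(** For [0 < i < n] the [i]-th power is at distance [2 * sin (pi * i / n) > 0] from 1. *)
Lemma expi_prim_root n : (0 < n)%N -> n.-primitive_root (expi (2 * pi / n%:R) : R[i]).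
Proof.
move=> n0; have nR : 0 < n%:R :> R by rewrite ltr0n.
have n1 : n%:R != 0 :> R by rewrite gt_eqF.
apply/andP; split => //; apply/forallP => -[i /= ilt].
apply/eqP; rewrite unity_rootE expi_natmul.
have [->|ni] := eqVneq i.+1 n.
  by rewrite mulrC divfK // /expi mulr_natl cos2pi sin2pi eqxx.
have iR : i.+1%:R < n%:R :> R by rewrite ltr_nat ltn_neqAle ni.
have i0 : 0 < i.+1%:R :> R by rewrite ltr0n.
apply/negbTE/eqP => /(congr1 (fun u => complex.Re `|u - 1|)).
rewrite subrr normr0 -[in X in X -> _]expi0 norm_expiB subr0 /=.
have -> : i.+1%:R * (2 * pi / n%:R) / 2 = pi * (i.+1%:R / n%:R) :> R by field.
have p0 := pi_gt0 R.
have s0 : 0 < sin (pi * (i.+1%:R / n%:R) : R).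
  apply: sin_gt0_pi; rewrite mulr_gt0 ?divr_gt0 //=.
  by rewrite gtr_pMr // ltr_pdivrMr // mul1r.
by rewrite gtr0_norm // => h; lra.
Qed.

Lemma sum_unity_root n (u : R[i]) : u ^+ n = 1 -> u != 1 -> \sum_(j < n) u ^+ j = 0.
Proof.
move=> un u1; apply/(mulfI (_ : u - 1 != 0)); first by rewrite subr_eq0.
by rewrite -subrX1 un subrr mulr0.
Qed.

Context {V : normedModType R[i]} (ip : V -> V -> R[i]).
Hypothesis ipP : is_inner_product ip.

Lemma ip_suml n (a : nat -> R[i]) (v : nat -> V) y :
  ip (\sum_(k < n) a k *: v k) y = \sum_(k < n) a k * ip (v k) y.
Proof.
case: ipP => lin _ _; elim: n => [|n IHn].
  by rewrite !big_ord0; have := lin (- 1) 0 0 y; rewrite scaler0 addr0 mulN1r addNr.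
by rewrite !big_ord_recr /= addrC lin IHn addrC.
Qed.

Lemma ip_sumr n (a : nat -> R[i]) (v : nat -> V) x :
  ip x (\sum_(k < n) a k *: v k) = \sum_(k < n) conjc (a k) * ip x (v k).
Proof.
case: ipP => _ sym _; rewrite sym ip_suml rmorph_sum.
by apply: eq_bigr => k _; rewrite rmorphM /= -sym.
Qed.

(** Expanding the inner products and exchanging sums leaves, for each pair [k], [l], a geometric sum
    in [z ^+ k * z^-1 ^+ l]: it is [n] on the diagonal and 0 off it. The transform is not
    normalised, whence the factor [n]. *)
Lemma parseval n (z : R[i]) (v : nat -> V) : n.-primitive_root z -> `|z| = 1 ->
  \sum_(j < n) rnorm (\sum_(k < n) (z ^+ j) ^+ k *: v k) ^+ 2 =
  n%:R * \sum_(k < n) rnorm (v k) ^+ 2.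
Proof.
move=> zn z1; have [_ _ nrm] := ipP.
have z0 : z != 0 by rewrite -normr_eq0 z1 oner_eq0.
have zc : conjc z = z^-1.
  by apply: (mulfI z0); rewrite divff // -sqr_normc z1 expr1n.
have zX m : conjc (z ^+ m) = z^-1 ^+ m.
  by rewrite rmorphXn; congr (_ ^+ _); exact: zc.
apply: (fmorph_inj (real_complex R : {rmorphism R -> R[i]})).
rewrite rmorphM rmorph_nat !rmorph_sum /=.
transitivity (\sum_(j < n) \sum_(k < n) \sum_(l < n)
    (z ^+ k * z^-1 ^+ l) ^+ j * ip (v k) (v l)).
  apply: eq_bigr => j _; rewrite -rnorm_sqr -nrm ip_suml.
  apply: eq_bigr => k _; rewrite ip_sumr mulr_sumr.
  apply: eq_bigr => l _; rewrite mulrA; congr (_ * _).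
  transitivity (z ^+ (j * k) * z^-1 ^+ (j * l)).
    by congr (_ * _); rewrite -exprM //; exact: zX.
  by rewrite exprMn -!exprM ![(j * _)%N]mulnC.
rewrite exchange_big /= mulr_sumr; apply: eq_bigr => k _.
rewrite exchange_big /= (bigD1 k) //= [X in _ + X]big1 ?addr0 => [|l lk].
  rewrite -mulr_suml nrm rnorm_sqr; congr (_ * _).
  rewrite -exprMn divff // expr1n.
  under eq_bigr => j _ do rewrite expr1n.
  by rewrite sumr_const card_ord.
rewrite -mulr_suml sum_unity_root ?mul0r //.
  by rewrite exprMn -!exprM ![(_ * n)%N]mulnC !exprM exprVn (prim_expr_order zn)
    invr1 !expr1n mulr1.
(* A ratio equal to 1 would give [z ^+ k = z ^+ l], hence [k = l], both being below [n]. *)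
rewrite exprVn -subr_eq0; apply: contra lk => /eqP h.
have : z ^+ k == z ^+ l.
  by apply/eqP; apply: (mulIf (invr_neq0 (expf_neq0 l z0)));
     rewrite divff ?expf_neq0 //; apply/eqP; rewrite -subr_eq0 h.
by rewrite (eq_prim_root_expr zn) !modn_small // eq_sym.
Qed.

End DiscreteFourier.

(** * From estimates on the circle to estimates on orbits *)

Section TransferPrinciple.
Context {R : realType} {V : normedModType R[i]}.
Implicit Types (T B : V -> V).

Lemma linear_sumZ T n (a : nat -> R[i]) (v : nat -> V) : linear T ->
  T (\sum_(k < n) a k *: v k) = \sum_(k < n) a k *: T (v k).
Proof.
move=> linT; elim: n => [|n IHn].
  by rewrite !big_ord0 -(subrr 0) (zmod_morphism_linear linT) !subrr.
by rewrite !big_ord_recr /= addrC linT IHn addrC.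
Qed.

Hypothesis hV : hilbert_norm V.

(* The discrete Fourier transform turns [v k.+1 - T (v k)] into
   [(w^-1 - T) y] at the frequency [w], so a pointwise bound on the unit circle
   becomes, by Parseval, a bound for periodic sequences. *)
Lemma periodic_transfer T B (c1 c2 : R) n (v : nat -> V) :
  linear T -> linear B ->
  (forall (lam : R[i]) y, `|lam| = 1 ->
     rnorm (B y) ^+ 2 <= c1 * rnorm y ^+ 2 + c2 * rnorm (lam *: y - T y) ^+ 2) ->
  (0 < n)%N -> v n = v 0%N ->
  \sum_(k < n) rnorm (B (v k)) ^+ 2 <=
    c1 * (\sum_(k < n) rnorm (v k) ^+ 2)
    + c2 * \sum_(k < n) rnorm (v k.+1 - T (v k)) ^+ 2.
Proof.
move=> linT linB bnd n0 vn; case: hV => ip ipP.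
have zn := @expi_prim_root R n n0.
move: (expi _) (norm_expi (2 * pi / n%:R : R)) zn => z z1 zn.
have nR : 0 < n%:R :> R by rewrite ltr0n.
(* Multiplying by the factor [n] of Parseval reduces the claim to one inequality per frequency. *)
rewrite -(ler_pM2l nR) mulrDr !(mulrCA n%:R).
rewrite -(parseval ipP (fun k => B (v k)) zn z1) -(parseval ipP v zn z1).
rewrite -(parseval ipP (fun k => v k.+1 - T (v k)) zn z1).
rewrite !mulr_sumr -big_split; apply: ler_sum => j _ /=.
set w := z ^+ j.
have w1 : `|w| = 1 by rewrite normrX z1 expr1n.
have w0 : w != 0 by rewrite -normr_eq0 w1 oner_eq0.
have /= BE := linear_sumZ n (fun k => w ^+ k) v linB.
have /= TE := linear_sumZ n (fun k => w ^+ k) v linT.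
rewrite -BE.
have -> : \sum_(k < n) w ^+ k *: (v k.+1 - T (v k)) =
    w^-1 *: (\sum_(k < n) w ^+ k *: v k) - T (\sum_(k < n) w ^+ k *: v k).
  rewrite TE.
  transitivity (\sum_(k < n) w ^+ k *: v k.+1 - \sum_(k < n) w ^+ k *: T (v k)).
    by rewrite -sumrB; apply: eq_bigr => k _; rewrite scalerBr.
  congr (_ - _).
  have wn : w ^+ n = 1 by rewrite exprAC (prim_expr_order zn) expr1n.
  (* A sum of [n.+1] terms is split at either end; the end terms cancel since [w ^+ n = 1] and
     [v n = v 0]. This is where periodicity enters. *)
  have := @big_ord_recl _ 0 +%R n (fun k : 'I_n.+1 => w ^+ k *: v k).
  rewrite big_ord_recr /= wn vn expr0 [X in _ = X -> _]addrC => /addIr h.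
  rewrite h scaler_sumr; apply: eq_bigr => k _.
  by rewrite scalerA /bump /= add1n exprS mulKf.
by apply: bnd; rewrite normfV w1 invr1.
Qed.

(** Mass of the squared weights on the rising half of the hat function; the induction step is
    [(n+1)^3 - n^3 <= 3 (n+1)^2]. *)
Lemma sum_sqr_ge n : n%:R ^+ 3 <= 3 * \sum_(k < n.+1) k%:R ^+ 2 :> R.
Proof.
elim: n => [|n IHn]; first by rewrite big_ord1 expr0n /= expr0n mulr0.
rewrite big_ord_recr /= mulrDr; have : 0 <= n%:R :> R by rewrite ler0n.
by rewrite [n.+1%:R]mulrSr; nra.
Qed.

Lemma power_decay T B (c1 c2 M : R) n x :
  linear T -> linear B -> (forall y, B (T y) = T (B y)) ->
  0 <= c1 -> 0 <= c2 ->
  (forall k y, rnorm (iter k T y) <= M * rnorm y) ->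
  (forall (lam : R[i]) y, `|lam| = 1 ->
     rnorm (B y) ^+ 2 <= c1 * rnorm y ^+ 2 + c2 * rnorm (lam *: y - T y) ^+ 2) ->
  n%:R ^+ 2 * rnorm (iter n T (B x)) ^+ 2 <=
    6 * M ^+ 4 * (c1 * n%:R ^+ 2 + c2) * rnorm x ^+ 2.
Proof.
move=> linT linB comm c10 c20 pow bnd.
have [->|n0] := posnP n.
  have M4 : 0 <= M ^+ 4 by rewrite exprn_even_ge0.
  rewrite expr0n /= mul0r mulr0 add0r.
  by apply: mulr_ge0 (sqr_ge0 _); apply: mulr_ge0 c20; apply: mulr_ge0 M4.
have Biter k y : B (iter k T y) = iter k T (B y).
  by elim: k => //= k <-; rewrite comm.
have nat_norm (k : nat) : complex.Re `|k%:R : R[i]| = k%:R.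
  by rewrite normr_nat -(rmorph_nat (real_complex R)).
(* The hat vanishes at 0 and [2n], which makes [v] periodic, has slopes 1 and -1, and equals [k] up
   to the peak at [n]. *)
pose g k : nat := minn k (n.*2 - k).
pose v k := (g k)%:R *: iter k T x : V.
have rnv k y : rnorm ((g k)%:R *: y : V) = (g k)%:R * rnorm y.
  by rewrite rnormZ nat_norm.
have n20 : (0 < n.*2)%N by rewrite double_gt0.
have vp : v n.*2 = v 0%N by rewrite /v /g subnn minn0 min0n !scale0r.
have := periodic_transfer linT linB bnd n20 vp.
have S1 : \sum_(k < n.*2) rnorm (v k) ^+ 2 <= n.*2%:R * (n%:R * M * rnorm x) ^+ 2.
  apply: le_trans (_ : \sum_(k < n.*2) (n%:R * M * rnorm x) ^+ 2 <= _).
    apply: ler_sum => k _; rewrite ler_pXn2r ?nnegrE ?rnorm_ge0 //; last first.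
      (* The power bound at exponent 0 supplies [0 <= M * rnorm x]. *)
      by rewrite -mulrA mulr_ge0 // (le_trans _ (pow 0%N x)) ?rnorm_ge0.
    rewrite rnv -mulrA ler_pM ?rnorm_ge0 // ler_nat /g; lia.
  by rewrite sumr_const card_ord [leRHS]mulr_natl.
have S2 : \sum_(k < n.*2) rnorm (v k.+1 - T (v k)) ^+ 2 <= n.*2%:R * (M * rnorm x) ^+ 2.
  apply: le_trans (_ : \sum_(k < n.*2) (M * rnorm x) ^+ 2 <= _).
    apply: ler_sum => k _; rewrite ler_pXn2r ?nnegrE ?rnorm_ge0 //; last first.
      by rewrite (le_trans _ (pow 0%N x)) ?rnorm_ge0.
    rewrite /v (scalable_linear linT) /= -iterS -scalerBl rnormZ -[leRHS]mul1r.
    apply: ler_pM; rewrite ?rnorm_ge0 //.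
      by rewrite normc_def sqrtr_ge0.
    (* The unit slope is phrased with successors, so no truncated subtraction enters the scalars. *)
    have [-> | ->] : g k.+1 = (g k).+1 \/ g k = (g k.+1).+1.
    - by rewrite /g; have := ltn_ord k; lia.
    - by rewrite mulrSr addrAC subrr add0r normr1.
    - by rewrite mulrSr opprD addrA subrr add0r normrN1.
  by rewrite sumr_const card_ord [leRHS]mulr_natl.
(* Only the terms [k <= n] are kept. There [g k = k], and factoring [T^n] as [T^(n-k) T^k] costs a
   factor [M]. *)
have S3 : n%:R ^+ 3 * rnorm (iter n T (B x)) ^+ 2 <=
    3 * M ^+ 2 * \sum_(k < n.*2) rnorm (B (v k)) ^+ 2.
  apply: le_trans (_ : 3 * \sum_(k < n.+1) k%:R ^+ 2 * rnorm (iter n T (B x)) ^+ 2 <= _).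
    by rewrite -mulr_suml mulrA ler_wpM2r ?sqr_ge0 ?sum_sqr_ge.
  rewrite -mulrA ler_pM2l ?ltr0n // mulr_sumr.
  rewrite (big_ord_widen n.*2 (fun k => k%:R ^+ 2 * _)); last lia.
  rewrite big_mkcond; apply: ler_sum => k _.
  case: ifP => [kn|_]; last by rewrite mulr_ge0 ?sqr_ge0.
  have gk : g k = k by rewrite /g; lia.
  rewrite /v (scalable_linear linB) rnv Biter gk exprMn [leRHS]mulrCA ler_wpM2l ?sqr_ge0 //.
  rewrite -exprMn ler_pXn2r ?nnegrE ?rnorm_ge0 //.
    by have := pow (n - k)%N (iter k T (B x)); rewrite -iterD subnK //; lia.
  by rewrite (le_trans _ (pow 0%N _)) ?rnorm_ge0.
have nR : 0 < n%:R :> R by rewrite ltr0n.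
(* The constant 6 is the 3 of [S3] times the 2 in the period [2n]; [M ^+ 4] collects [M ^+ 2] from
   [S3] and from [S1], [S2]. *)
move=> S4; rewrite -(ler_pM2l nR) [leLHS]mulrA -exprS; apply: le_trans S3 _.
have M20 : 0 <= 3 * M ^+ 2 by rewrite mulr_ge0 ?sqr_ge0.
apply: le_trans (ler_wpM2l M20 S4) _.
apply: le_trans (ler_wpM2l M20 (lerD (ler_wpM2l c10 S1) (ler_wpM2l c20 S2))) _.
by rewrite -muln2 natrM le_eqVlt; apply/orP; left; apply/eqP; ring.
Qed.

End TransferPrinciple.

(** * Resolvent bounds, written as lower bounds for [lam - T] *)

Section Resolvent.
Context {R : realType} {V : normedModType R[i]}.
Variable T : V -> V.

Lemma expi_neq1 (t : R) : 0 < `|t| <= pi -> expi t <> 1.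
Proof.
have p0 := pi_gt0 R.
wlog t0 : t / 0 <= t => [H|].
  have [/H//|t0 tp] := leP 0 t; have := H (- t); rewrite normrN oppr_ge0 (ltW t0).
  move=> /(_ isT tp) h e; apply: h; move: e; rewrite /expi cosN sinN.
  by case=> -> ->; rewrite oppr0.
rewrite ger0_norm // => /andP[t1 t2].
move=> /(congr1 (fun u => complex.Re `|u - 1|)).
rewrite subrr normr0 -[in X in X -> _]expi0 norm_expiB subr0 /=.
have s0 : 0 < sin (t / 2) by apply: sin_gt0_pi; apply/andP; split; lra.
by rewrite gtr0_norm // => h; lra.
Qed.

Lemma norm_expiB_le (s t : R) : complex.Re `|expi s - expi t| <= `|s - t|.
Proof.
rewrite norm_expiB; apply: le_trans (_ : 2 * `|(s - t) / 2| <= _).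
  by rewrite ler_pM2l ?ltr0n // sin_le_norm.
by rewrite normrM (@ger0_norm _ 2^-1) ?invr_ge0 ?ler0n // mulrC divfK.
Qed.

(** Replacing [lam] by [mu] adds an error of at most [rnorm y / 2], which the left side absorbs. *)
Lemma resolvent_perturb (lam mu : R[i]) (m : R) y : 0 <= m ->
  rnorm y <= m * rnorm (lam *: y - T y) ->
  m * complex.Re `|lam - mu| <= 1 / 2 ->
  rnorm y <= 2 * m * rnorm (mu *: y - T y).
Proof.
move=> m0 h d.
have e : lam *: y - T y = (mu *: y - T y) + (lam - mu) *: y.
  by rewrite scalerBl addrAC addrCA subrr addr0.
have := rnormD (mu *: y - T y) ((lam - mu) *: y).
rewrite -e rnormZ; have := rnorm_ge0 y; nra.
Qed.

(** Perturbation makes each pointwise bound locally uniform; compactness then makes it uniform on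
    [A]. *)
Lemma resolvent_compact (A : set R) : compact A ->
  (forall t, A t -> exists S, is_inverse_op (shift_op (expi t) T) S) ->
  exists2 K : R, 0 <= K &
    forall t y, A t -> rnorm y <= K * rnorm (expi t *: y - T y).
Proof.
move=> /compact_near_coveringP cA inv.
pose P (K t : R) := forall y, rnorm y <= K * rnorm (expi t *: y - T y).
have : \forall K \near +oo%R, (A `<=` P K)%classic.
  apply: cA => t At; have [S [[_ [m hm]] [ST _]]] := inv t At.
  pose m' := `|m| + 1.
  have m0 : 0 < m' by rewrite ltr_wpDl.
  have hS y : rnorm y <= m' * rnorm (expi t *: y - T y).
    have := hm (shift_op (expi t) T y); rewrite rnorm_le ST => h.
    apply: le_trans h _; apply: ler_wpM2r; first exact: rnorm_ge0.
    by rewrite /m'; have := ler_norm m; lra.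
  (* With radius [1 / (2 m')], the Lipschitz bound on [expi] meets the 1/2 required by
     [resolvent_perturb]. *)
  exists (ball t (2 * m')^-1, [set K | 2 * m' < K]%classic) => /=.
    split; first by apply: nbhsx_ballx; rewrite invr_gt0 mulr_gt0 ?ltr0n.
    by apply: nbhs_pinfty_gt; exact: num_real.
  move=> [s K] /= [ts /ltW mK] y.
  apply: le_trans (_ : 2 * m' * rnorm (expi s *: y - T y) <= _).
    apply: resolvent_perturb (hS y) _; first exact: ltW.
    apply: le_trans (ler_wpM2l (ltW m0) (norm_expiB_le _ _)) _.
    have := ltW ts; rewrite /ball /= invfM => h.
    apply: le_trans (ler_wpM2l (ltW m0) h) _.
    by rewrite mulrCA divff ?gt_eqF // mulr1 div1r.
  by apply: ler_wpM2r => //; exact: rnorm_ge0.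
by move=> /pinfty_ex_gt0[K K0 h]; exists K => [|t y At]; [exact: ltW|exact: h].
Qed.

End Resolvent.

(** * From resolvent growth to decay of powers *)

Section Rates.
Context {R : realType} {V : normedModType R[i]}.
Implicit Types (T : V -> V) (alpha : R).

(** The hypothesis covers angles below [delta]; the two remaining arcs are compact and avoid 1. *)
Lemma resolvent_growth T alpha (C delta : R) : 1 <= alpha ->
  (forall t : R, 0 < `|t| <= pi -> exists S, is_inverse_op (shift_op (expi t) T) S) ->
  0 < delta ->
  (forall t : R, 0 < `|t| < delta ->
     forall S, is_inverse_op (shift_op (expi t) T) S ->
     forall x, `|S x| <= (C * powR `|t| (- alpha))%:C * `|x|) ->
  exists2 K : R, 0 <= K & forall t y, 0 < `|t| <= pi ->
    rnorm y <= K * powR `|t| (- alpha) * rnorm (expi t *: y - T y).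
Proof.
move=> alpha_ge1 inv d0 near0.
have [t|K1 K10 H1] := @resolvent_compact _ _ T `[delta, pi]%classic (@segment_compact _ _ _).
  by rewrite /= in_itv /= => /andP[da ap]; apply: inv; rewrite ger0_norm ?ap ?andbT; lra.
have [t|K2 K20 H2] := @resolvent_compact _ _ T `[- pi, - delta]%classic (@segment_compact _ _ _).
  rewrite /= in_itv /= => /andP[da ap]; apply: inv.
  by rewrite ler0_norm; [apply/andP; split|]; lra.
have p0 := pi_gt0 R.
have pa0 : 0 < powR pi alpha := powR_gt0 _ p0.
(* Since [pi^alpha * |t|^(-alpha) >= 1], the constant bounds on the arcs take the form of the bound
   near 0. *)
exists (`|C| + (K1 + K2) * powR pi alpha).
  by rewrite addr_ge0 ?mulr_ge0 ?addr_ge0 // ltW.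
move=> t y /andP[t0 tp].
have q0 : 0 < powR `|t| (- alpha) := powR_gt0 _ t0.
set Y := rnorm (expi t *: y - T y).
have Y0 : 0 <= Y := rnorm_ge0 _.
have [td|td] := ltP `|t| delta.
  have [|S [bS [ST TS]]] := inv t; first by rewrite t0 tp.
  have := near0 t _ S (conj bS (conj ST TS)) (shift_op (expi t) T y).
  rewrite t0 td rnorm_le ST -/Y => /(_ isT) h; apply: le_trans h _.
  apply: ler_wpM2r => //; apply: ler_wpM2r; first exact: ltW.
  by apply: le_trans (ler_norm _) _; rewrite lerDl mulr_ge0 ?addr_ge0 // ltW.
have q1 : 1 <= powR pi alpha * powR `|t| (- alpha).
  rewrite powRN ler_pdivlMr ?powR_gt0 // mul1r.
  by apply: ge0_ler_powR; rewrite ?nnegrE ?(ltW p0) ?(le_trans ler01 alpha_ge1).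
have h : rnorm y <= (K1 + K2) * Y.
  have [t1|t1] := leP 0 t.
    apply: le_trans (H1 t y _) _.
      by rewrite /= in_itv /=; move: td tp; rewrite ger0_norm // => -> ->.
    by apply: ler_wpM2r => //; rewrite lerDl.
  apply: le_trans (H2 t y _) _.
    by rewrite /= in_itv /=; move: td tp; rewrite ltr0_norm // => ? ?; apply/andP; split; lra.
  by apply: ler_wpM2r => //; rewrite lerDr.
apply: le_trans h _; apply: ler_wpM2r => //.
apply: le_trans (_ : (K1 + K2) * (powR pi alpha * powR `|t| (- alpha)) <= _).
  by rewrite ler_peMr ?addr_ge0.
by rewrite [leLHS]mulrA [leRHS]mulrDl lerDr mulr_ge0 // ltW.
Qed.

Lemma sqr_le_double (p a b : R) : 0 <= p -> p <= a + b ->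
  p ^+ 2 <= 2 * a ^+ 2 + 2 * b ^+ 2.
Proof. by move=> p0 h; have := sqr_ge0 (a - b); nra. Qed.

Lemma one_minus_T_bound T alpha (K eps : R) (lam : R[i]) y : 1 <= alpha ->
  0 <= K ->
  (forall t z, 0 < `|t| <= pi ->
    rnorm z <= K * powR `|t| (- alpha) * rnorm (expi t *: z - T z)) ->
  0 < eps <= 1 -> `|lam| = 1 ->
  rnorm (y - T y) <= eps * rnorm y
    + (K + 1) * powR eps (1 - alpha) * rnorm (lam *: y - T y).
Proof.
move=> alpha_ge1 K0 growth /andP[e0 e1] /expi_surj[t tpi ->].
have {}tpi : `|t| <= pi by rewrite ler_norml.
set Y := rnorm (expi t *: y - T y).
have Y0 : 0 <= Y := rnorm_ge0 _.
(* As [eps <= 1] and [1 - alpha <= 0], this factor absorbs the bare residual [Y], which accounts for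
   the 1 in [K + 1]. *)
have E1 : 1 <= powR eps (1 - alpha).
  rewrite -[leLHS](powRr0 eps); apply: ger_powR; first by rewrite e0.
  lra.
have step : rnorm (y - T y) <= `|t| * rnorm y + Y.
  have -> : y - T y = (expi 0 - expi t) *: y + (expi t *: y - T y).
    by rewrite scalerBl expi0 scale1r addrA subrK.
  apply: le_trans (rnormD _ _) _; rewrite lerD2r rnormZ.
  apply: ler_wpM2r; first exact: rnorm_ge0.
  by apply: le_trans (norm_expiB_le _ _) _; rewrite sub0r normrN.
apply: le_trans step _.
have n0 : 0 <= rnorm y := rnorm_ge0 _.
have [te|te] := leP `|t| eps.
  apply: lerD; first exact: ler_wpM2r.
  by rewrite -[leLHS]mul1r; apply: ler_wpM2r => //; nra.
have t0 : 0 < `|t| := lt_trans e0 te.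
have h : `|t| * rnorm y <= K * powR eps (1 - alpha) * Y.
  have := growth t y; rewrite t0 tpi => /(_ isT) /(ler_wpM2l (ltW t0)) g.
  apply: le_trans g _; rewrite -/Y mulrA; apply: ler_wpM2r => //.
  rewrite mulrCA; apply: ler_wpM2l => //.
  have -> : `|t| * powR `|t| (- alpha) = powR `|t| (1 - alpha).
    by rewrite powRD ?(gt_eqF t0) ?implybT // powRr1 // ltW.
  rewrite -(opprB alpha) !powRN lef_pV2 ?posrE ?powR_gt0 //.
  by apply: ge0_ler_powR; rewrite ?nnegrE ?subr_ge0 ?(ltW e0) ?(ltW te).
have : 0 <= eps * rnorm y by rewrite mulr_ge0 // ltW.
have : Y <= powR eps (1 - alpha) * Y by rewrite ler_peMl.
rewrite !mulrDl mul1r; lra.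
Qed.

Lemma decay_of_growth T alpha (M K : R) : 1 <= alpha -> hilbert_norm V -> linear T ->
  0 <= M -> (forall n y, rnorm (iter n T y) <= M * rnorm y) ->
  0 <= K ->
  (forall t z, 0 < `|t| <= pi ->
    rnorm z <= K * powR `|t| (- alpha) * rnorm (expi t *: z - T z)) ->
  forall n x, (0 < n)%N ->
  rnorm (iter n T (x - T x)) <=
    4 * M ^+ 2 * (K + 2) * powR n%:R (- alpha^-1) * rnorm x.
Proof.
move=> alpha_ge1 hV linT M0 pow K0 growth n x n0.
have a0 : 0 < alpha by lra.
have nR : 0 < n%:R :> R by rewrite ltr0n.
have n1 : 1 <= n%:R :> R by rewrite ler1n.
set eps := powR n%:R (- alpha^-1).
have e0 : 0 < eps := powR_gt0 _ nR.
have e1 : eps <= 1.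
  rewrite -[leRHS](powRr0 n%:R); apply: ler_powR => //.
  by rewrite oppr_le0 invr_ge0 ltW.
(* This choice of [eps] balances the two terms: [eps * n] and [eps^(1-alpha)] coincide. *)
have Ee : powR eps (1 - alpha) = n%:R * eps.
  rewrite /eps -powRrM mulrDr mulr1 mulrNN mulVf ?gt_eqF //.
  by rewrite powRD ?(gt_eqF nR) ?implybT // powRr1 1?mulrC // ltW.
have linB : linear (fun y => y - T y).
  by move=> a u w; rewrite linT scalerBr opprD addrACA.
set D := (K + 1) * (n%:R * eps).
have D0 : 0 <= D by rewrite mulr_ge0 ?addr_ge0 ?mulr_ge0 // ltW.
have bnd (lam : R[i]) y : `|lam| = 1 -> rnorm (y - T y) ^+ 2 <=
    2 * eps ^+ 2 * rnorm y ^+ 2 + 2 * D ^+ 2 * rnorm (lam *: y - T y) ^+ 2.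
  move=> lam1; have e01 : 0 < eps <= 1 by rewrite e0.
  have := sqr_le_double (rnorm_ge0 _) (one_minus_T_bound y alpha_ge1 K0 growth e01 lam1).
  by rewrite Ee -/D !exprMn !mulrA.
have comm y : T y - T (T y) = T (y - T y) by rewrite (zmod_morphism_linear linT).
have c1 : 0 <= 2 * eps ^+ 2 by rewrite mulr_ge0 ?sqr_ge0.
have c2 : 0 <= 2 * D ^+ 2 by rewrite mulr_ge0 ?sqr_ge0.
have := power_decay hV n x linT linB comm c1 c2 pow bnd.
set Y := rnorm (iter n T _); set X := rnorm x => h.
have X0 : 0 <= X := rnorm_ge0 _.
rewrite -(ler_pXn2r (n:=2)) ?nnegrE ?rnorm_ge0 //; last first.
  by rewrite !mulr_ge0 ?addr_ge0 ?sqr_ge0 // ltW.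
rewrite -(ler_pM2l (exprn_gt0 2 nR)); apply: le_trans h _.
have -> : n%:R ^+ 2 * (4 * M ^+ 2 * (K + 2) * eps * X) ^+ 2 =
  M ^+ 4 * X ^+ 2 * (n%:R * eps) ^+ 2 * (16 * (K + 2) ^+ 2) by ring.
have -> : 6 * M ^+ 4 * (2 * eps ^+ 2 * n%:R ^+ 2 + 2 * D ^+ 2) * X ^+ 2 =
  M ^+ 4 * X ^+ 2 * (n%:R * eps) ^+ 2 * (12 * (1 + (K + 1) ^+ 2)).
  by rewrite /D; ring.
(* What remains is [12 (1 + (K+1)^2) <= 16 (K+2)^2], which explains the constant [4 * (K + 2)]. *)
apply: ler_wpM2l; last by nra.
apply: mulr_ge0 (sqr_ge0 _); apply: mulr_ge0 (sqr_ge0 _).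
exact: exprn_even_ge0.
Qed.

End Rates.

(** * From decay of powers to resolvent growth *)

Section Converse.
Context {R : realType} {V : normedModType R[i]}.
Implicit Types (T : V -> V) (alpha : R).

Lemma norm_1Bexpi_ge : exists2 d : R, 0 < d & forall t : R, `|t| < d ->
  `|t| / 2 <= complex.Re `|expi 0 - expi t|.
Proof.
have [d d0 H] := @sin_ge_half R; exists d => // t td.
have h2 : `|(0 - t) / 2| = `|t| / 2.
  by rewrite sub0r normrM normrN (@ger0_norm _ 2^-1) ?invr_ge0.
have := H ((0 - t) / 2); rewrite norm_expiB h2; have := normr_ge0 t; lra.
Qed.

Lemma iter_linB T n (a : R[i]) u w : linear T ->
  iter n T (a *: u - w) = a *: iter n T u - iter n T w.
Proof.
move=> linT; elim: n => //= n ->.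
by rewrite (zmod_morphism_linear linT) (scalable_linear linT).
Qed.

(** Telescoping: each further power adds one term [T^n (lam y - T y)], of norm at most [M] times the
    residual. *)
Lemma iter_approx_eigen T (M : R) (lam : R[i]) y n : linear T ->
  `|lam| = 1 -> (forall k z, rnorm (iter k T z) <= M * rnorm z) ->
  rnorm (lam ^+ n *: y - iter n T y) <= n%:R * M * rnorm (lam *: y - T y).
Proof.
move=> linT lam1 pow; elim: n => [|n IHn].
  by rewrite expr0 scale1r subrr !mul0r /rnorm normr0.
have -> : lam ^+ n.+1 *: y - iter n.+1 T y =
    lam *: (lam ^+ n *: y - iter n T y) + iter n T (lam *: y - T y).
  by rewrite iter_linB // scalerBr scalerA -exprS addrA subrK -iterSr.
apply: le_trans (rnormD _ _) _.
rewrite rnormZ lam1 mul1r [n.+1%:R]mulrSr !mulrDl mul1r lerD //.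
Qed.

Lemma growth_of_decay T alpha (M C : R) N : 1 <= alpha -> linear T ->
  0 <= M -> (forall n y, rnorm (iter n T y) <= M * rnorm y) ->
  (forall n x, (N <= n)%N ->
     rnorm (iter n T (x - T x)) <= C * powR n%:R (- alpha^-1) * rnorm x) ->
  exists K delta : R, 0 < delta /\ forall t y, 0 < `|t| < delta ->
    rnorm y <= K * powR `|t| (- alpha) * rnorm (expi t *: y - T y).
Proof.
move=> a1 linT M0 pow decay.
have [d d0 lower] := norm_1Bexpi_ge.
have a0 : 0 < alpha by lra.
pose C1 := `|C| + 1.
have C10 : 0 < C1 by rewrite ltr_wpDl.
pose E := powR (4 * C1) alpha + N.+1%:R.
exists (4 * M * (E + 1)), (Num.min d 1); split; first by rewrite lt_min d0 ltr01.
move=> t y /andP[t0]; rewrite lt_min => /andP[td t1].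
set q := powR `|t| (- alpha).
have q0 : 0 < q := powR_gt0 _ t0.
(* Here [|t| <= 1 <= alpha]; this later absorbs the term [M * W], which carries no factor [|t|]. *)
have tq : 1 <= `|t| * q.
  have <- : powR `|t| (1 - alpha) = `|t| * q.
    by rewrite powRD ?(gt_eqF t0) ?implybT // powRr1 // ltW.
  rewrite -[leLHS](powRr0 `|t|); apply: ger_powR; last by lra.
  by rewrite t0 ltW.
have q1 : 1 <= q by nra.
(* Solution of [C1 * u^(-1/alpha) = |t| / 4]; the integer [n] below exceeds both [u] and [N]. *)
pose u := powR (4 * C1 / `|t|) alpha.
have v0 : 0 < 4 * C1 / `|t| by rewrite divr_gt0 ?mulr_gt0.
have u0 : 0 < u := powR_gt0 _ v0.
have uE : u = powR (4 * C1) alpha * q.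
  rewrite /u powRM ?invr_ge0 ?mulr_ge0 ?ltW //.
  by rewrite /q -powR_inv1 ?normr_ge0 // -powRrM mulN1r.
pose n := (Num.trunc u + N.+1)%N.
have un : u <= n%:R.
  by rewrite /n -addSnnS natrD (le_trans (ltW (truncnS_gt u))) // lerDl.
have nE : n%:R <= E * q.
  rewrite /n natrD /E mulrDl -uE lerD ?ler_peMr //.
  by rewrite truncn_le ltW.
have small : C1 * powR n%:R (- alpha^-1) <= `|t| / 4.
  have h : powR n%:R (- alpha^-1) <= (4 * C1 / `|t|)^-1.
    have -> : 4 * C1 / `|t| = powR u (alpha^-1).
      by rewrite /u -powRrM divff ?gt_eqF // powRr1 // ltW.
    rewrite powRN lef_pV2 ?posrE ?powR_gt0 //; last by apply: lt_le_trans un.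
    by apply: ge0_ler_powR; rewrite ?nnegrE ?invr_ge0 ?(ltW a0) ?(ltW u0).
  apply: le_trans (ler_wpM2l (ltW C10) h) _.
  by rewrite le_eqVlt; apply/orP; left; apply/eqP; field; rewrite !gt_eqF.
set s := complex.Re `|expi 0 - expi t|.
have s1 : `|t| / 2 <= s := lower t td.
have s2 : s <= `|t| by apply: le_trans (norm_expiB_le _ _) _; rewrite sub0r normrN.
set W := rnorm (expi t *: y - T y); set Y := rnorm y.
have Y0 : 0 <= Y := rnorm_ge0 _. have W0 : 0 <= W := rnorm_ge0 _.
have far : Y - n%:R * M * W <= rnorm (iter n T y).
  have := iter_approx_eigen y n linT (norm_expi t) pow.
  have := rnormD (expi t ^+ n *: y - iter n T y) (iter n T y).
  rewrite subrK rnormZ normrX norm_expi expr1n mul1r -/W -/Y; lra.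
have near : s * rnorm (iter n T y) <= `|t| / 4 * Y + M * W.
  have Nn : (N <= n)%N by rewrite /n addnS ltnW // ltnS leq_addl.
  have Cn : C <= C1 by rewrite /C1; have := ler_norm C; lra.
  have -> : s * rnorm (iter n T y) = rnorm ((expi 0 - expi t) *: iter n T y).
    by rewrite rnormZ.
  have -> : (expi 0 - expi t) *: iter n T y =
      iter n T (y - T y) - iter n T (expi t *: y - T y).
    have := iter_linB n 1 y (T y) linT; rewrite !scale1r => ->.
    by rewrite iter_linB // expi0 scalerBl scale1r opprB addrA subrK.
  apply: le_trans (rnormB _ _) _; apply: lerD (pow _ _).
  apply: le_trans (decay _ _ Nn) _; apply: ler_wpM2r => //.
  by apply: le_trans small; apply: ler_wpM2r; rewrite ?powR_ge0.
(* Together, [|t|/2 * Y <= s*n*M*W + |t|/4 * Y + M*W]. Absorbing the [Y] term leaves [|t|/4 * Y],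
   whence the factor 4; [n <= E * q] and [1 <= |t| * q] give [E + 1]. *)
have key : `|t| * Y <= `|t| * (4 * M * (E + 1) * q * W).
  have MW : 0 <= M * W by rewrite mulr_ge0.
  have h1 : s * (n%:R * (M * W)) <= `|t| * (E * q * (M * W)).
    by rewrite ler_pM ?mulr_ge0 ?ler_wpM2r //; lra.
  have h2 : M * W <= `|t| * q * (M * W) by rewrite ler_peMl.
  have h3 : s * (Y - n%:R * M * W) <= s * rnorm (iter n T y).
    by rewrite ler_wpM2l //; lra.
  have h4 : `|t| / 2 * Y <= s * Y by rewrite ler_wpM2r.
  move: h1 h2 h3 h4 near; rewrite mulrBr !mulrA; lra.
by move: key; rewrite ler_pM2l.
Qed.

End Converse.

Theorem theorem3p10 (R : realType) (X : completeNormedModType R[i])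
    (T : X -> X) (alpha : R) :
  hilbert_norm X ->
  bounded_op T ->
  power_bounded T ->
  (forall lam : R[i], `|lam| = 1 -> (in_spectrum T lam <-> lam = 1)) ->
  1 <= alpha ->
  ((* ||R(e^{i theta}, T)|| = O(|theta|^{-alpha}) as theta -> 0 *)
   (exists (C delta : R), 0 < delta /\
      forall theta : R, 0 < `|theta| < delta ->
      forall S : X -> X, is_inverse_op (shift_op (expi theta) T) S ->
      forall x : X, `|S x| <= (C * powR `|theta| (- alpha))%:C * `|x|)
   <->
   (* ||T^n (I - T)|| = O(n^{-1/alpha}) as n -> oo *)
   (exists (C : R) (N : nat), forall n : nat, (N <= n)%N ->
      forall x : X, `|iter n T (x - T x)| <= (C * powR n%:R (- alpha^-1))%:C * `|x|)).
Proof.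
move=> hX [linT _] [M0 bM] spec alpha_ge1.
pose M := `|M0|.
have pow n x : rnorm (iter n T x) <= M * rnorm x.
  have := bM n x; rewrite rnorm_le => h; apply: le_trans h _.
  by apply: ler_wpM2r (rnorm_ge0 _) _ _ (ler_norm _).
split=> [[C [delta [delta_gt0 near0]]]|[C [N decay]]].
- have inv (t : R) : 0 < `|t| <= pi -> exists S, is_inverse_op (shift_op (expi t) T) S.
    by move=> /expi_neq1 t1; apply: contrapT => /(spec _ (norm_expi t)).1.
  have [K K0 growth] := resolvent_growth alpha_ge1 inv delta_gt0 near0.
  (* The threshold 1 excludes [n = 0], where [powR] with a negative exponent is 0 by convention. *)
  exists (4 * M ^+ 2 * (K + 2)), 1%N => n n0 x; rewrite rnorm_le.
  exact: decay_of_growth alpha_ge1 hX linT (normr_ge0 _) pow K0 growth _ _ n0.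
- have [n x Nn|K [delta [delta_gt0 growth]]] :=
      @growth_of_decay _ _ T alpha M C N alpha_ge1 linT (normr_ge0 _) pow.
    by rewrite -rnorm_le; exact: decay.
  (* The lower bound is applied to [y = S x], for which [(lam - T) y = x]. *)
  exists K, delta; split=> // t t_small S [_ [_ TS]] x; rewrite rnorm_le.
  by have := growth t (S x) t_small; have := TS x; rewrite /shift_op => ->.
Qed.
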